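(* Let $\dot S_n$ be the subgroup of $B_n$ generated by $s_1,\dots,s_{n-1}$, and let $\pi\in\dot S_n$ have generalized standard $OGS$ presentation $$\pi=\tau_{k_1}^{i_{k_1}}\cdot\tau_{k_2}^{i_{k_2}}\cdots\tau_{k_m}^{i_{k_m}}$$ such that $-k_j\le i_{k_j}\le k_j-1$ for every $1\le j\le m$, $\sum_{j=1}^m i_{k_j}=0$, and $0\le\sum_{j=r}^m i_{k_j}\le k_{r-1}$ for every $2\le r\le m$. Then $$\ell(\pi)=\sum_{j=1}^m k_j\cdot i_{k_j}.$$
   Context: $B_n$ is the group of signed permutations, i.e. the bijections $\pi$ of $\{\pm1,\dots,\pm n\}$ with $\pi(-i)=-\pi(i)$. It is a Coxeter group with generators $s_0,\dots,s_{n-1}$, where $s_0$ exchanges $1$ and $-1$, and for $1\le i\le n-1$, $s_i$ exchanges $i$ with $i+1$ and $-i$ with $-(i+1)$; $\ell$ is the Coxeter length with respect to these generators. Products are read from left to right: $(\pi_1\cdot\pi_2)(i)=\pi_2(\pi_1(i))$. For $1\le k\le n$, $\tau_k=s_0s_1\cdots s_{k-1}$. Every element of $B_n$ has a unique presentation $\tau_1^{i_1}\cdots\tau_n^{i_n}$ with integers $-k\le i_k<k$, called its generalized standard $OGS$ presentation; omitting trivial factors it is written $\tau_{k_1}^{i_{k_1}}\cdots\tau_{k_m}^{i_{k_m}}$ with $k_1<\dots<k_m$. (The three conditions on the exponents hold automatically for elements of $\dot S_n$.) *)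

(* Defs.v *)
From mathcomp Require Import all_boot all_order all_algebra all_fingroup.

Set Implicit Arguments.
Unset Strict Implicit.
Unset Printing Implicit Defensive.

Import GroupScope.

(* The pair (j, b) stands for the element (-1)^b * (j + 1) of {+-1, ..., +-n}. *)
Definition signed (n : nat) : finType := ('I_n * bool)%type.

Definition sneg (n : nat) (x : signed n) : signed n := (x.1, ~~ x.2).

(* The product of {perm T} is the left-to-right one: (p * q) x = q (p x). *)
Definition signed_perms (n : nat) : {set {perm signed n}} :=
  [set p : {perm signed n} | [forall x, p (sneg x) == sneg (p x)]].

Fact signed_perms_group_set (n : nat) : group_set (signed_perms n).
Proof.
apply/group_setP; split=> [|p q].
  by rewrite inE; apply/forallP => x; rewrite !perm1.
rewrite !inE => /forallP hp /forallP hq; apply/forallP => x.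
by rewrite !permM (eqP (hp x)) (eqP (hq _)).
Qed.

Canonical signed_perms_group (n : nat) : {group {perm signed n}} :=
  Group (signed_perms_group_set n).

(* Because of the shift in [signed], s_i with i > 0 exchanges the entries of
   index i - 1 and i; [ord_pred i] is i - 1 for such an i. *)
Definition cox_gen (n : nat) (i : 'I_n) : {perm signed n} :=
  if i == 0 :> nat then tperm (i, false) (i, true)
  else tperm (ord_pred i, false) (i, false) * tperm (ord_pred i, true) (i, true).

Definition cox_gens (n : nat) : {set {perm signed n}} :=
  [set cox_gen i | i : 'I_n].

Definition dotS (n : nat) : {group {perm signed n}} :=
  <<[set cox_gen i | i : 'I_n & (0 < i)%N]>>%G.

Lemma val_ord_pred (n : nat) (i : 'I_n) : i <> 0 :> nat -> ord_pred i = i.-1 :> nat.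
Proof.
case: i => [[|i] hi] //= _.
by rewrite -[RHS](modn_small (ltnW hi)) -[RHS]modnDr.
Qed.

Lemma cox_gen0E (n : nat) (i : 'I_n) (x : signed n) :
  i = 0 :> nat -> cox_gen i x = (x.1, x.2 (+) (x.1 == i)).
Proof.
case: x => j b i0; rewrite /cox_gen i0 /= permE /= !xpair_eqE.
by case: (eqVneq j i) => [->|_]; case: b.
Qed.

Lemma cox_genE (n : nat) (i : 'I_n) (x : signed n) :
  i <> 0 :> nat -> cox_gen i x = (tperm (ord_pred i) i x.1, x.2).
Proof.
case: x => j b /[dup] i0 /eqP/negPf; rewrite /cox_gen /= => ->.
have ne : i != ord_pred i.
  apply/eqP => /(congr1 (@nat_of_ord n)); rewrite val_ord_pred //.
  by case: (nat_of_ord i) i0 => //= a _ /esym; apply: n_Sn.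
have neb c c' (j1 j2 : 'I_n) : c != c' -> (j1, c) != (j2, c').
  by move=> cc'; rewrite xpair_eqE (negPf cc') andbF.
rewrite permM; case: tpermP => [->|->|/eqP h1 /eqP h2]; case: b => *.
- by rewrite [tperm (_, false) _ _]tpermD ?neb // tpermL.
- by rewrite tpermL tpermD ?neb.
- by rewrite [tperm (_, false) _ _]tpermD ?neb // tpermR.
- by rewrite tpermR tpermD ?neb.
- by rewrite !tpermD // xpair_eqE eq_sym ?(negPf h1) ?(negPf h2) ?andbF.
- by rewrite !tpermD // xpair_eqE eq_sym ?(negPf h1) ?(negPf h2) ?andbF.
Qed.

Lemma cox_gen_neg (n : nat) (i : 'I_n) x :
  cox_gen i (sneg x) = sneg (cox_gen i x).
Proof.
have [i0|/eqP i0] := eqVneq (nat_of_ord i) 0; last by rewrite !cox_genE.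
by rewrite !cox_gen0E // /sneg /= addNb.
Qed.

Lemma cox_gen_fix (n : nat) (i : 'I_n) (x : signed n) :
  (i < x.1)%N -> cox_gen i x = x.
Proof.
case: x => j b /= ij; have ne : i != j by rewrite neq_ltn ij.
have [i0|/eqP i0] := eqVneq (nat_of_ord i) 0.
  by rewrite cox_gen0E //= eq_sym (negPf ne) addbF.
rewrite cox_genE //= tpermD //.
apply/eqP => /(congr1 (@nat_of_ord n)); rewrite val_ord_pred // => jE.
by move: ij; rewrite -jE ltnNge leq_pred.
Qed.

Lemma cox_gen_move (n : nat) (i j : 'I_n) b :
  i = j.+1 :> nat -> cox_gen i (j, b) = (i, b) /\ cox_gen i (i, b) = (j, b).
Proof.
move=> ij; have i0 : i <> 0 :> nat by rewrite ij.
have jE : ord_pred i = j by apply: ord_inj; rewrite val_ord_pred ?ij.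
by rewrite !cox_genE //= jE tpermL tpermR.
Qed.

Lemma cox_gen_flip (n : nat) (i : 'I_n) b :
  i = 0 :> nat -> cox_gen i (i, b) = (i, ~~ b).
Proof. by move=> i0; rewrite cox_gen0E //= eqxx addbT. Qed.

Lemma cox_gens_trans (n : nat) (k j : 'I_n) b :
  (j <= k)%N -> exists2 g, g \in <<cox_gens n>> &
    g (j, b) = (k, false) /\ forall x : signed n, (k < x.1)%N -> g x = x.
Proof.
have genP i : cox_gen i \in <<cox_gens n>> by rewrite mem_gen ?imset_f.
have up c : forall d (i : 'I_n), (i + d)%N = k ->
    exists2 g, g \in <<cox_gens n>> &
    g (i, c) = (k, c) /\ forall x : signed n, (k < x.1)%N -> g x = x.
  elim=> [|d IH] i.
    rewrite addn0 => /val_inj ->; exists 1 => //.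
    by split=> [|x]; rewrite perm1.
  rewrite addnS => idk; have i1 : (i.+1 < n)%N.
    by apply: leq_ltn_trans (ltn_ord k); rewrite -idk ltnS leq_addr.
  have [|g gG [gi gx]] := IH (Ordinal i1); first by rewrite -idk.
  exists (cox_gen (Ordinal i1) * g); first by rewrite groupM.
  split=> [|x kx].
    by rewrite permM; case: (@cox_gen_move n (Ordinal i1) i c erefl) => -> _.
  rewrite permM cox_gen_fix ?gx //=; apply: leq_ltn_trans kx.
  by rewrite -idk ltnS leq_addr.
have down c : forall d (i : 'I_n), i = d :> nat -> (i <= k)%N ->
    exists2 g, g \in <<cox_gens n>> &
    g (i, c) = (i, ~~ c) /\ forall x : signed n, (k < x.1)%N -> g x = x.
  elim=> [|d IH] i id ik.
    exists (cox_gen i) => //; split=> [|x kx]; first exact: cox_gen_flip.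
    by apply: cox_gen_fix; apply: leq_ltn_trans kx.
  have d1 : (d < n)%N by have := ltn_ord i; rewrite id => /ltnW.
  have [||g gG [gi gx]] := IH (Ordinal d1) => //=.
    by apply: leq_trans ik; rewrite id.
  exists (cox_gen i * g * cox_gen i); first by rewrite !groupM.
  split=> [|x kx].
    by rewrite !permM; case: (@cox_gen_move n i (Ordinal d1) c id) => _ ->;
      rewrite gi; case: (@cox_gen_move n i (Ordinal d1) (~~ c) id) => ->.
  by rewrite !permM !(cox_gen_fix, gx) //; apply: leq_ltn_trans kx.
move=> jk; case: b.
  have [h hG [hj hx]] := down true _ j erefl jk.
  have [g gG [gj gx]] := up false _ j (subnKC jk).
  exists (h * g); first by rewrite groupM.
  by split=> [|x kx]; rewrite permM ?hj ?gj ?hx ?gx.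
exact: (up false _ j (subnKC jk)).
Qed.

Lemma gen_cox_gens (n : nat) : <<cox_gens n>> = signed_perms n.
Proof.
have sub : <<cox_gens n>> \subset signed_perms n.
  rewrite gen_subG; apply/subsetP => _ /imsetP[i _ ->].
  by rewrite inE; apply/forallP => x; rewrite cox_gen_neg.
apply/eqP; rewrite eqEsubset sub; apply/subsetP => p pB.
have key : forall k, (k <= n)%N -> forall q, q \in signed_perms n ->
    (forall x : signed n, (k <= x.1)%N -> q x = x) -> q \in <<cox_gens n>>.
  elim=> [|k IH] kn q qB qx.
    suff -> : q = 1 by [].
    by apply/permP => x; rewrite perm1 qx.
  pose K := Ordinal kn; case E: (q (K, false)) => [j b].
  have jk : (j <= K)%N.
    rewrite leqNgt; apply/negP => /= kj.
    have qj : q (j, b) = (j, b) by apply: qx.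
    by move: kj; rewrite -qj in E; case/perm_inj: E => <- _; rewrite ltnn.
  have [g gG [gj gx]] := cox_gens_trans b jk.
  rewrite -(groupMr _ gG); apply: IH; first exact: ltnW.
    by rewrite groupM // (subsetP sub).
  have fixK : (q * g) (K, false) = (K, false) by rewrite permM E gj.
  have: q * g \in signed_perms n by rewrite groupM // (subsetP sub).
  rewrite inE => /forallP/(_ (K, false))/eqP; rewrite fixK /sneg /= => fixK'.
  case=> i c /=; rewrite leq_eqVlt => /orP[/eqP ki|ki].
    by have -> : i = K by [apply: val_inj]; case: c.
  by rewrite permM qx ?gx.
by apply: (key n) => // x; rewrite leqNgt ltn_ord.
Qed.

Definition is_word (n : nat) (p : {perm signed n}) (l : nat) : bool :=
  [exists w : l.-tuple 'I_n, \prod_(i <- w) cox_gen i == p].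

Lemma ex_word (n : nat) (p : {perm signed n}) :
  p \in signed_perms n -> exists l, is_word p l.
Proof.
rewrite -gen_cox_gens => /gen_prodgP[l [c cP ->]]; exists l.
have /fin_all_exists[f fP] i : exists j : 'I_n, c i = cox_gen j.
  by have /imsetP[j _ ->] := cP i; exists j.
apply/existsP; exists [tuple f i | i < l]; rewrite big_tuple.
by apply/eqP/eq_bigr => i _; rewrite tnth_mktuple fP.
Qed.

(* Outside B_n, where no word exists, the value is the dummy 0. *)
Definition cox_length (n : nat) (p : {perm signed n}) : nat :=
  if @idP (p \in signed_perms n) is ReflectT pB then ex_minn (ex_word pB) else 0.

Definition expgz (gT : finGroupType) (x : gT) (z : int) : gT :=
  match z with Posz a => x ^+ a | Negz a => x ^- a.+1 end.

(* For k <= n this is s_0 * s_1 * ... * s_(k-1), in this order. *)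
Definition tau (n k : nat) : {perm signed n} :=
  \prod_(i < n | (i < k)%N) cox_gen i.

(* p = tau_(k_1) ^ e_1 * ... * tau_(k_m) ^ e_m is the generalized standard OGS
   presentation with trivial factors omitted; the ordinal j : 'I_m carries the
   data of the (j + 1)-st factor, e j being the exponent i_(k_(j+1)). *)
Record is_OGS (n m : nat) (k : 'I_m -> nat) (e : 'I_m -> int)
    (p : {perm signed n}) : Prop := IsOGS {
  OGS_index : forall j, (1 <= k j <= n)%N;
  OGS_increasing : forall j j' : 'I_m, (j < j')%N -> (k j < k j')%N;
  OGS_exponent : forall j, (- (k j)%:Z <= e j < (k j)%:Z)%R;
  OGS_nontrivial : forall j, e j <> 0%R;
  OGS_prod : p = \prod_(j < m) expgz (tau n (k j)) (e j) }.

(* Main.v *)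
(* With T_r the sum of the exponents of index >= r (so T_1 = 0), summation by
   parts writes p as the product over r >= 2 of
   tau_(k_(r-1)) ^ (- T_r) * tau_(k_r) ^ T_r.  For 0 <= T_r <= k_(r-1) such a
   factor involves no signs: it exchanges two adjacent blocks of T_r and
   k_r - k_(r-1) values.  The preceding factors fix all points of the second
   block and permute the points up to k_(r-1), so each factor adds exactly
   T_r * (k_r - k_(r-1)) inversions.

   The length of a sign-free p is its number of inversions: counting inversions
   among the images of 1, ..., n, right multiplication by s_i exchanges two
   adjacent values and creates at most one inversion, while s_0 creates none,
   since only one of 1 and -1 is the image of a positive point. *)
Require Import Defs.
From mathcomp Require Import all_boot all_order all_algebra all_fingroup.
From mathcomp Require Import zify.

Set Implicit Arguments.
Unset Strict Implicit.
Unset Printing Implicit Defensive.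

Import Order.TTheory GroupScope.

Lemma expgz_subn (gT : finGroupType) (x : gT) (a b : nat) :
  expgz x (a%:Z - b%:Z)%R = x ^+ a * x ^- b.
Proof.
case: (leqP b a) => [ba|ab].
  have -> : (a%:Z - b%:Z)%R = (a - b)%N by lia.
  by rewrite /= -{2}(subnK ba) expgD mulgK.
have -> : (a%:Z - b%:Z)%R = Negz (b - a).-1 by lia.
rewrite /= prednK ?subn_gt0 // -{2}(subnK (ltnW ab)) expgD invMg mulgA.
by rewrite mulgV mul1g.
Qed.

(** * Inversions and the effect of one generator *)

Section Inversions.

Variable n : nat.
Implicit Types (x y : signed n) (p : {perm signed n}) (s : 'S_n) (i j : 'I_n).

Definition signed_val x : int :=
  (if x.2 then - (x.1.+1)%:Z else (x.1.+1)%:Z)%R.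

Definition inversions p : {set 'I_n * 'I_n} :=
  [set ab : 'I_n * 'I_n | (ab.1 < ab.2)%N
          & (signed_val (p (ab.2, false)) < signed_val (p (ab.1, false)))%R].

(** A generator with [i > 0] exchanges neighbouring values of equal sign, so it reverses only these
    neighbours; on the negative side the larger index is the smaller value. The generator s_0
    reverses only -1 and 1, a pair excluded by [x.1 <> y.1]. *)
Lemma cox_gen_new_inversion i x y :
  x.1 <> y.1 -> (signed_val x < signed_val y)%R ->
  (signed_val (cox_gen i y) < signed_val (cox_gen i x))%R ->
  [/\ x.2 = y.2, x.1 = (if x.2 then i else ord_pred i)
     & y.1 = (if x.2 then ord_pred i else i)].
Proof.
case: x => [a c]; case: y => [b d] /= ab; have {}ab : a <> b :> nat.
  by move=> /val_inj.
have [i0|/eqP i0] := eqVneq (nat_of_ord i) 0%N.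
  rewrite !cox_gen0E // /signed_val /= -!val_eqE /= i0.
  by case: c; case: d; do 2![case: eqP => /= ?]; lia.
have ip := val_ord_pred i0; move: ip; rewrite !cox_genE // /signed_val /=.
set i' := ord_pred i => ip.
rewrite !permE /= -!val_eqE /= => h1 h2.
suff: [/\ c = d, a = (if c then i else i') :> nat
  & b = (if c then i' else i) :> nat].
  by case=> -> ha hb; split=> //; apply: val_inj; rewrite /= ?ha ?hb; case: (d).
by move: h1 h2; case: c; case: d;
  do ?[case: eqP => ? /=]; move=> *; split=> //; lia.
Qed.

Lemma card_inversions_gen p i :
  p \in signed_perms n -> (#|inversions (p * cox_gen i)| <= #|inversions p|.+1)%N.
Proof.
rewrite inE => /forallP pneg.
rewrite -(cardsID (inversions p)) -addn1 leq_add //.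
  by rewrite subset_leq_card // subsetIr.
apply/card_le1_eqP => -[a b] [a' b'].
have new u v : (u, v) \in inversions (p * cox_gen i) :\: inversions p ->
    exists c, p (u, false) = (if c then i else ord_pred i, c)
           /\ p (v, false) = (if c then ord_pred i else i, c).
  rewrite !inE /= !permM => /and3P[+ uv]; rewrite uv /= -leNgt => le lt.
  have ne : (p (u, false)).1 <> (p (v, false)).1.
    case E: (p (u, false)) => [w c]; case F: (p (v, false)) => [w' d] /= ww.
    rewrite {}ww in E.
    have := pneg (v, false); rewrite /sneg F /= => /eqP G.
    case: (eqVneq c d) => cd.
      by move: uv; rewrite cd -F in E; case: (perm_inj E) => ->; rewrite ltnn.
    have cd' : c = ~~ d by case: (c) (d) cd => [] [].
    by rewrite cd' -G in E; have := perm_inj E.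
  have lt' : (signed_val (p (u, false)) < signed_val (p (v, false)))%R.
    rewrite lt_neqAle le andbT; apply/eqP => E; apply: ne; move: E.
    case: (p _) => [w c]; case: (p _) => [w' d]; rewrite /signed_val /= => E.
    by apply: val_inj => /=; case: c d E => [] []; lia.
  have := cox_gen_new_inversion ne lt' lt.
  case: (p (u, _)) => [w c]; case: (p (v, _)) => [w' d] /= [-> -> ->].
  by exists d.
move=> /new[c [pa pb]] /new[c' [pa' pb']].
(* Two new inversions with different signs [c] would send two positive points to opposite values,
   although [p] commutes with negation. With equal signs the positions coincide by injectivity. *)
have clash u v w : p (u, false) = (w, false) -> p (v, false) <> (w, true).
  move=> pu pv; have /eqP := pneg (u, false); rewrite pu /sneg /= -pv.
  by move/perm_inj.
case: c c' pa pb pa' pb' => [] [] /=.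
- by move=> <- <- /perm_inj[->] /perm_inj[->].
- by move=> _ pb pa' _; case: (clash _ _ _ pa' pb).
- by move=> pa _ _ pb'; case: (clash _ _ _ pa pb').
- by move=> <- <- /perm_inj[->] /perm_inj[->].
Qed.

Lemma cox_prod_signed (w : seq 'I_n) :
  \prod_(i <- w) cox_gen i \in signed_perms n.
Proof.
apply: group_prod => i _.
by rewrite inE; apply/forallP => x; rewrite cox_gen_neg.
Qed.

Lemma card_inversions_word (w : seq 'I_n) :
  (#|inversions (\prod_(i <- w) cox_gen i)%g| <= size w)%N.
Proof.
elim/last_ind: w => [|w i IH].
  rewrite big_nil leqn0 cards_eq0; apply/eqP/setP => -[a b].
  by rewrite !inE !perm1 /signed_val /= ltNge andbC; case: ltnP => //=; lia.
rewrite -cats1 big_cat big_seq1 size_cat addn1 /=.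
exact/(leq_trans (card_inversions_gen _ (cox_prod_signed w))).
Qed.

(** * Sign-free elements and their length *)

Fact perm_signed_inj s : injective (fun x : signed n => (s x.1, x.2)).
Proof. by case=> [a c] [b d] [/perm_inj -> ->]. Qed.

Definition perm_signed s : {perm signed n} := perm (@perm_signed_inj s).

Lemma perm_signedE s x : perm_signed s x = (s x.1, x.2).
Proof. by rewrite permE. Qed.

Lemma perm_signedM s t : perm_signed (s * t) = perm_signed s * perm_signed t.
Proof. by apply/permP => x; rewrite permM !perm_signedE permM. Qed.

Lemma perm_signed1 : perm_signed 1 = 1.
Proof. by apply/permP => -[a c]; rewrite perm_signedE !perm1. Qed.

Lemma signed_perms_sign_free p : p \in signed_perms n ->
  (forall j, (p (j, false)).2 = false) -> exists s, p = perm_signed s.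
Proof.
rewrite inE => /forallP pneg p0.
have inj : injective (fun j => (p (j, false)).1).
  move=> a b ab; have : p (a, false) = p (b, false).
    by move: ab (p0 a) (p0 b); case: (p _) => ? ?; case: (p _) => ? ? /= -> -> ->.
  by move/perm_inj => -[].
exists (perm inj); apply/permP => -[a c]; rewrite perm_signedE permE /=.
have pa : p (a, false) = ((p (a, false)).1, false).
  by move: (p0 a); case: (p _) => ? ? /= ->.
case: c => //; have /eqP := pneg (a, false).
by rewrite /sneg p0 /= => ->.
Qed.

Lemma cox_gen_perm_signed i : i <> 0%N :> nat ->
  cox_gen i = perm_signed (tperm (ord_pred i) i).
Proof. by move=> i0; apply/permP => x; rewrite cox_genE // perm_signedE. Qed.

Lemma inversions_perm_signed s (a b : 'I_n) :
  ((a, b) \in inversions (perm_signed s)) = (a < b)%N && (s b < s a)%N.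
Proof. by rewrite inE !perm_signedE /signed_val /=; congr (_ && _); lia. Qed.

Lemma increasing_perm s :
  (forall i j, j = i.+1 :> nat -> (s i < s j)%N) -> s = 1.
Proof.
move=> inc; have far d i j : (i + d)%N = j -> (s i + d <= s j)%N.
  elim: d j => [|d IH] j ij.
    by rewrite addn0 (_ : i = j) //; apply: ord_inj; rewrite -ij addn0.
  have jn := ltn_ord j; have idn : (i + d < n)%N by lia.
  have /= := IH (Ordinal idn) erefl; have /= := @inc (Ordinal idn) j; lia.
apply/permP => i; rewrite perm1; apply: val_inj => /=.
have in_ := ltn_ord i; have n0 : (0 < n)%N by lia.
have n1 : (n.-1 < n)%N by lia.
(* Counting up from index 0 gives [i <= s i]; counting up to the last index gives [s i <= i]. *)
have := far (n.-1 - i)%N i (Ordinal n1); have := far i (Ordinal n0) i erefl.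
have := ltn_ord (s (Ordinal n1)); rewrite /=; lia.
Qed.

(** Bubble sort: as long as two consecutive values stand in decreasing order, the generator
    exchanging them removes an inversion; if there are none, the inverse is increasing and [s] is
    1. *)
Lemma perm_signed_word s : exists w : seq 'I_n,
  (size w <= #|inversions (perm_signed s)|)%N /\
  \prod_(i <- w) cox_gen i = perm_signed s.
Proof.
have [d] := ubnP #|inversions (perm_signed s)|; elim: d s => // d IH s.
rewrite ltnS => sd.
have [/existsP[i /andP[i0 desc]]|nodesc] :=
    boolP [exists i : 'I_n, (0 < i)%N && (s^-1%g i < s^-1%g (ord_pred i))%N]; last first.
  exists [::]; rewrite big_nil -perm_signed1; split=> //; congr perm_signed.
  apply/esym/invg_inj; rewrite invg1; apply: increasing_perm => i j ij.
  have j0 : j <> 0%N :> nat by rewrite ij.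
  have -> : i = ord_pred j by apply: ord_inj; rewrite val_ord_pred ?ij.
  move: nodesc; rewrite negb_exists => /forallP/(_ j).
  rewrite ij /= -leqNgt leq_eqVlt => /orP[|//].
  move/eqP/ord_inj/perm_inj/(congr1 (@nat_of_ord n)).
  rewrite val_ord_pred // ij /=.
  lia.
have {}i0 : i <> 0%N :> nat by lia.
pose t := s * tperm (ord_pred i) i.
have ip := val_ord_pred i0.
have lt : (#|inversions (perm_signed t)| < #|inversions (perm_signed s)|)%N.
  apply/proper_card/properP; split.
    apply/subsetP => -[a b]; rewrite !inversions_perm_signed => /andP[ab].
    rewrite ab !permM !permE /=; move: (ord_pred i) desc ip => i' desc ip.
    (* Only a pair with the lower of the two values at the earlier position could become an
       inversion, and the descent rules it out. *)
    have : ~~ ((s b == i :> nat) && (s a == i' :> nat)).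
      apply/negP => /andP[/eqP/ord_inj sb /eqP/ord_inj sa].
      by move: desc; rewrite -sa -sb !permK ltnNge (ltnW ab).
    by rewrite -!val_eqE /=; do ?[case: eqP => ? /=]; lia.
  exists (s^-1 i, s^-1 (ord_pred i)); rewrite inversions_perm_signed ?desc /=.
    by rewrite !permKV; lia.
  by rewrite !permM !permKV tpermL tpermR; lia.
have [w [sw Ew]] := IH t (leq_trans lt sd).
exists (rcons w i); rewrite size_rcons (leq_ltn_trans sw lt); split=> //.
rewrite -cats1 big_cat big_seq1 Ew /= cox_gen_perm_signed // -perm_signedM.
by rewrite /t -mulgA tperm2 mulg1.
Qed.

Lemma cox_length_perm_signed s :
  cox_length (perm_signed s) = #|inversions (perm_signed s)|.
Proof.
have [w [sw Ew]] := perm_signed_word s.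
(* The dummy value 0 does not arise: the word [w] shows membership in [signed_perms n]. *)
rewrite /cox_length; case: {-}_ / idP => [pB|]; last first.
  by rewrite -Ew cox_prod_signed.
case: ex_minnP => l /existsP[v /eqP Ev] minl; apply/eqP; rewrite eqn_leq.
apply/andP; split.
  apply: leq_trans sw; apply: minl; apply/existsP; exists (in_tuple w).
  by rewrite /= Ew.
by rewrite -Ev (leq_trans (card_inversions_word v)) // size_tuple.
Qed.

End Inversions.

(** * Powers of [tau] and block swaps *)

Section TauPowers.

Variable n : nat.
Implicit Types (x : signed n) (k l T : nat).

Lemma tau0 : tau n 0 = 1.
Proof. by rewrite /tau big_pred0. Qed.

Lemma tauS k (kn : (k < n)%N) : tau n k.+1 = tau n k * cox_gen (Ordinal kn).
Proof.
rewrite /tau (big_ord_narrow kn) (big_ord_narrow (ltnW kn)) big_ord_recr /=.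
congr (_ * cox_gen _); last exact: val_inj.
by apply: eq_bigr => i _; congr cox_gen; apply: val_inj.
Qed.

Lemma tau_signed k : tau n k \in signed_perms n.
Proof.
apply: group_prod => i _; rewrite inE; apply/forallP => x.
by rewrite cox_gen_neg.
Qed.

(** Acting from left to right, s_0 negates the entry 1 and the later generators carry it to -k, each
    lowering one of the values 2, ..., k: a rotation with one sign change. *)
Lemma tauE k x : (k <= n)%N ->
  ((tau n k x).1 = (if (k <= x.1)%N then x.1 : nat
                    else if x.1 == 0%N :> nat then k.-1 else x.1.-1)%N :> nat)
  * ((tau n k x).2 = x.2 (+) ((x.1 < k) && (x.1 == 0 :> nat))%N).
Proof.
elim: k => [|k IH] kn; first by rewrite tau0 perm1 addbF.
have {IH} := IH (ltnW kn); rewrite tauS permM.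
case: (tau n k x) => a c; case: x => j b /= [aE ->].
set K := Ordinal kn; have [k0|/eqP k0] := eqVneq (nat_of_ord K) 0%N.
  rewrite cox_gen0E //= -val_eqE /= aE; move: k0; rewrite /= => ->.
  rewrite leq0n ltn0 /= addbF; split; last by congr addb; lia.
  by do ?[case: ifP => ? /=]; lia.
rewrite cox_genE //; move: (ord_pred K) (val_ord_pred k0) => K' K'E.
rewrite permE /= -!val_eqE /= in k0 K'E *.
split; last by congr addb; lia.
by move: aE; do ?[case: ifP => ? /=]; lia.
Qed.

(** Within [T <= k] rotations a point leaves index 0 at most once, so its sign changes at most
    once. *)
Lemma tauXE k T x : (k <= n)%N -> (T <= k)%N ->
  (((tau n k ^+ T) x).1 = (if (k <= x.1)%N then x.1 : nat
                    else if (T <= x.1)%N then x.1 - T else k + x.1 - T)%N :> nat)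
  * (((tau n k ^+ T) x).2 = x.2 (+) (x.1 < T)%N).
Proof.
move=> kn; elim: T => [|T IH] Tk.
  by rewrite expg0 perm1 addbF subn0; split=> //; case: ifP.
rewrite expgSr permM !tauE //; have {IH} := IH (ltnW Tk).
case: (_ x) => a c; case: x => j b /= [aE ->]; rewrite -addbA.
split; first by move: aE; do ?[case: ifP => ? /=]; lia.
by congr addb; move: aE; do ?[case: ifP => ? /=]; lia.
Qed.

Lemma tauXVE k T x : (k <= n)%N -> (T <= k)%N ->
  (((tau n k ^- T) x).1 = (if (k <= x.1)%N then x.1 : nat
              else if (x.1 + T < k)%N then x.1 + T else x.1 + T - k)%N :> nat)
  * (((tau n k ^- T) x).2 = x.2 (+) (x.1 < k <= x.1 + T)%N).
Proof.
move=> kn Tk; have := permKV (tau n k ^+ T) x.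
case: ((tau n k ^- T) x) => a c E; have [] := tauXE (a, c) kn Tk; rewrite E.
case: x {E} => j b /= jE ->; rewrite -addbA.
split; first by move: jE; do ?[case: ifP => ? /=]; lia.
rewrite -[LHS]addbF; congr addb.
by move: jE; do ?[case: ifP => ? /=]; lia.
Qed.

(* On indices, the word in one-line notation exchanges the adjacent blocks
   [k - T, k) and [k, l). *)
Lemma tau_block_swap k l T : (T <= k)%N -> (k <= l)%N -> (l <= n)%N ->
  exists2 s : 'S_n, tau n k ^- T * tau n l ^+ T = perm_signed s
  & forall j, s j = (if (j < k - T)%N then j : nat else
                     if (j < k)%N then j + (l - k) else
                     if (j < l)%N then j - T else j)%N :> nat.
Proof.
move=> Tk kl ln; pose w := tau n k ^- T * tau n l ^+ T.
have kn := leq_trans kl ln; have Tl := leq_trans Tk kl.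
have wE x : ((w x).1 = (if (x.1 < k - T)%N then x.1 : nat else
                     if (x.1 < k)%N then x.1 + (l - k) else
                     if (x.1 < l)%N then x.1 - T else x.1)%N :> nat)
            * ((w x).2 = x.2).
  rewrite permM; have := tauXE ((tau n k ^- T) x) ln Tl.
  have := tauXVE x kn Tk; case: ((tau n k ^- T) x) => a c; case: ((tau n l ^+ T) (a, c)) => a' c'.
  case: x => j b /= [aE ->] [a'E ->]; rewrite -addbA.
  split; first by move: aE a'E; do ?[case: ifP => ? /=]; lia.
  (* The points negated by [tau n k ^- T] are those it sends below index [T], exactly the ones that
     [tau n l ^+ T] negates again. *)
  rewrite -[RHS]addbF; congr addb.
  by move: aE; do ?[case: ifP => ? /=]; lia.
have [||s sE] := @signed_perms_sign_free n w.
- by rewrite groupM ?groupV ?groupX ?tau_signed.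
- by move=> j; rewrite wE.
exists s => // j; have /= := wE (j, false).
by rewrite sE perm_signedE => -[].
Qed.

Lemma card_ord_interval a b : (b <= n)%N ->
  #|[set i : 'I_n | (a <= i < b)%N]| = (b - a)%N.
Proof.
move=> bn; rewrite -[RHS]muln1 -sum_nat_const_nat (big_nat_widen _ _ n) //.
rewrite (big_nat_widenl _ 0%N) // big_mkord cardsE -sum1_card.
by apply: eq_bigl => i; rewrite unfold_in /= andbC.
Qed.

Lemma card_inversions_block_swap k l T (q s : 'S_n) :
  (T <= k)%N -> (k <= l)%N -> (l <= n)%N ->
  (forall j : 'I_n, (k <= j)%N -> q j = j) ->
  (forall j : 'I_n, s j = (if (j < k - T)%N then j : nat else
                     if (j < k)%N then j + (l - k) else
                     if (j < l)%N then j - T else j)%N :> nat) ->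
  #|inversions (perm_signed (q * s))|
    = (#|inversions (perm_signed q)| + T * (l - k))%N.
Proof.
move=> Tk kl ln qfix sE; have kn := leq_trans kl ln.
have qlt j : (k <= q j)%N = (k <= j)%N.
  apply/idP/idP => [|kj]; last by rewrite qfix.
  by move=> /[dup] kq /qfix/perm_inj <-.
pose A := [set a : 'I_n | (k - T <= a < k)%N].
pose B := [set b : 'I_n | (k <= b < l)%N].
(* [s] reverses the order exactly between values in [A] and values in [B]. Since [q] fixes [B]
   pointwise and permutes the indices below [k], the new inversions are the pairs in [q @^-1: A]
   times [B]. *)
have -> : inversions (perm_signed (q * s))
    = inversions (perm_signed q) :|: setX (q @^-1: A) B.
  apply/setP => -[a b]; rewrite in_setU in_setX !inversions_perm_signed.
  rewrite !inE /= !permM.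
  have qab : (a < b)%N -> q a <> q b :> nat.
    by move=> ab /ord_inj/perm_inj ab'; rewrite ab' ltnn in ab.
  have qnat (j : 'I_n) : (k <= j)%N -> q j = j :> nat by move=> /qfix ->.
  have := qlt a; have := qlt b; have := qnat b; have := qnat a; rewrite !sE.
  by move: {qnat} (q a) (q b) qab => a' b'; do ?[case: ifP => ? /=]; lia.
rewrite cardsU cardsX card_preimset; last exact: perm_inj.
rewrite !card_ord_interval // subKn // (_ : _ :&: _ = set0) ?cards0 ?subn0 //.
(* The union is disjoint: an inversion of [q] cannot end at a position [b >= k]. *)
apply/setP => -[a b]; rewrite in_setI in_setX inversions_perm_signed !inE.
have := qlt a; have [kb|bk] := leqP k b; last by rewrite !andbF.
by rewrite (qfix b kb) /=; lia.
Qed.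

End TauPowers.

(* Here [t] is the sequence of tail sums of the exponents; the extra power of
   [tau n (k r)] makes each partial product sign-free. *)
Lemma partial_product_inversions n m (k t : nat -> nat) :
  (forall r, (r < m)%N -> (k r <= k r.+1)%N) ->
  (forall r, (r <= m)%N -> (k r <= n)%N) ->
  (forall r, (r < m)%N -> (t r.+1 <= k r)%N) ->
  t 0%N = 0%N -> forall r, (r <= m)%N ->
  exists s : 'S_n,
    [/\ \prod_(j < r) expgz (tau n (k j)) ((t j)%:Z - (t j.+1)%:Z)%R
          * tau n (k r) ^+ t r = perm_signed s,
        forall j : 'I_n, (k r <= j)%N -> s j = j
      & #|inversions (perm_signed s)|%:Z%R
          = (\sum_(j < r) (k j)%:Z * ((t j)%:Z - (t j.+1)%:Z)
             + (k r)%:Z * (t r)%:Z)%R].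
Proof.
move=> k_mono k_le t_le t0; elim=> [|r IH] rm.
  exists 1; rewrite !big_ord0 t0 expg0 mulg1 perm_signed1; split=> //.
    by move=> j; rewrite perm1.
  have := @card_inversions_word n [::]; rewrite big_nil /=; lia.
have [q [qE qfix q_inv]] := IH (ltnW rm).
have tk := t_le r rm; have kk := k_mono r rm; have kn := k_le r.+1 rm.
have [s sE s_val] := tau_block_swap tk kk kn.
exists (q * s); split.
(* The new factor splits in two: its positive power completes the previous partial product, its
   negative power opens the block swap. *)
- rewrite perm_signedM -qE -sE big_ord_recr /= expgz_subn.
  by rewrite -!mulgA.
- move=> j kj; rewrite permM qfix; last exact: leq_trans kj.
  apply: ord_inj; rewrite s_val; do ?[case: ifP => ? /=]; lia.
rewrite (card_inversions_block_swap tk kk kn qfix s_val) big_ord_recr /=.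
move: q_inv kk tk; set S := (\sum_(_ < r) _)%R; set I := #|_|; nia.
Qed.

(** * Tail sums of the exponents and the length formula *)

Local Open Scope ring_scope.

Theorem theorem5p0p2 (n m : nat) (k : 'I_m -> nat) (e : 'I_m -> int)
    (p : {perm signed n})
    (p_dotS : p \in dotS n)
    (p_OGS : is_OGS k e p)
    (e_range : forall j : 'I_m, - (k j)%:Z <= e j <= (k j)%:Z - 1)
    (e_sum : \sum_(j < m) e j = 0)
    (e_tail : forall q r : 'I_m, r = q.+1 :> nat ->
       0 <= \sum_(j < m | (r <= j)%N) e j <= (k q)%:Z) :
  (cox_length p)%:Z = \sum_(j < m) (k j)%:Z * e j.
Proof.
case: p_OGS => k_range k_inc _ _ pE.
(* The default [n] at index [m] gives the last block swap an upper end; its width is the tail sum at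
   [m], which is 0. *)
pose k' i := oapp k n (insub i).
have k'E (j : 'I_m) : k' j = k j by rewrite /k' valK.
have k'm : k' m = n by rewrite /k' insubF // ltnn.
pose t' i := \sum_(j < m | (i <= j)%N) e j.
have t'0 : t' 0%N = 0 by rewrite -[RHS]e_sum.
have t'm : t' m = 0.
  by rewrite /t' big_pred0 // => j; rewrite leqNgt ltn_ord.
have t'_bound r : (r < m)%N -> 0 <= t' r.+1 <= (k' r)%:Z.
  move=> rm; have [r1|] := ltnP r.+1 m.
    by have := @e_tail (Ordinal rm) (Ordinal r1) erefl; rewrite -k'E.
  by move=> mr; rewrite (_ : r.+1 = m) ?t'm //; lia.
(* The tail sums up to index [m] are nonnegative, so the absolute value only turns them into natural
   numbers. *)
pose t i := `|t' i|%N.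
have tE i : (i <= m)%N -> (t i)%:Z = t' i.
  by case: i => [|i] im; rewrite /t ?t'0 //; have := t'_bound i im; lia.
have eE (j : 'I_m) : (t j)%:Z - (t j.+1)%:Z = e j.
  have jm := ltn_ord j; rewrite !tE ?(ltnW jm) // /t' (bigD1 j) //=.
  suff -> : \sum_(i < m | (j <= i)%N && (i != j)) e i
    = \sum_(i < m | (j < i)%N) e i by rewrite GRing.addrK.
  by apply: eq_bigl => i; rewrite -val_eqE /=; lia.
have k'_mono r : (r < m)%N -> (k' r <= k' r.+1)%N.
  move=> rm; rewrite -[r]/(val (Ordinal rm)) k'E /=.
  have [r1|mr] := ltnP r.+1 m.
    by rewrite -[r.+1]/(val (Ordinal r1)) k'E ltnW // k_inc.
  rewrite (_ : r.+1 = m) ?k'm; last by lia.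
  by case/andP: (k_range (Ordinal rm)).
have k'_le r : (r <= m)%N -> (k' r <= n)%N.
  rewrite leq_eqVlt => /orP[/eqP ->|rm]; first by rewrite k'm.
  by rewrite -[r]/(val (Ordinal rm)) k'E; case/andP: (k_range (Ordinal rm)).
have t_le r : (r < m)%N -> (t r.+1 <= k' r)%N.
  by move=> rm; have := t'_bound r rm; rewrite -tE //; lia.
have t0 : t 0%N = 0%N by rewrite /t t'0.
have tm : t m = 0%N by rewrite /t t'm.
have [s [sE _ s_inv]] :=
  partial_product_inversions k'_mono k'_le t_le t0 (leqnn m).
have ps : p = perm_signed s.
  rewrite pE -sE tm expg0 mulg1.
  by apply: eq_bigr => j _; rewrite k'E eE.
rewrite ps cox_length_perm_signed s_inv tm GRing.mulr0 GRing.addr0.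
by apply: eq_bigr => j _; rewrite k'E eE.
Qed.
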